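(* Let $(\mu,\ell,\mathcal{W},\mathcal{A})$ be a learning tuple and let $n\ge 1$, with sample $\mathcal{S}_n=(Z_1,\dots,Z_n)$ i.i.d. from $\mu$ and output hypothesis $W$ of $\mathcal{A}$ on $\mathcal{S}_n$. Assume that $r(W,Z)=\ell(W,Z)-\ell(w^*,Z)$ is $\sigma$-sub-Gaussian under the product distribution $P_W\otimes\mu$. Then for any $\eta$ with $$0<\eta<\frac{2\,\mathbb{E}_{P_W\otimes\mu}[r(W,Z)]}{\sigma^2},$$ and with $$a_\eta=1-\frac{\eta\sigma^2}{2\,\mathbb{E}_{P_W\otimes\mu}[r(W,Z)]},$$ it holds that $$\mathbb{E}_{W\mathcal{S}_n}\left[\mathcal{E}(W,\mathcal{S}_n)\right]\le \frac{1-a_\eta}{a_\eta}\,\mathbb{E}_{W\mathcal{S}_n}\left[\hat{\mathcal{R}}(W,\mathcal{S}_n)\right]+\frac{1}{n\eta a_\eta}\sum_{i=1}^n I(W;Z_i).$$ Furthermore, $$\mathbb{E}_{W}\left[\mathcal{R}(W)\right]\le \frac{1}{a_\eta}\,\mathbb{E}_{W\mathcal{S}_n}\left[\hat{\mathcal{R}}(W,\mathcal{S}_n)\right]+\frac{1}{n\eta a_\eta}\sum_{i=1}^n I(W;Z_i).$$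
   Context: Setting. $\mathcal{Z}$ is the instance space, $\mu$ a probability distribution on $\mathcal{Z}$, $\mathcal{W}$ the hypothesis space, $\ell:\mathcal{W}\times\mathcal{Z}\to\mathbb{R}$ a loss function. The sample $\mathcal{S}_n=(Z_1,\dots,Z_n)$ consists of i.i.d. draws from $\mu$. A (possibly randomised) algorithm $\mathcal{A}:\mathcal{Z}^n\to\mathcal{W}$, i.e. a conditional distribution $P_{W|\mathcal{S}_n}$, produces the hypothesis $W$. The tuple $(\mu,\ell,\mathcal{W},\mathcal{A})$ is called a learning tuple. $P_{W\mathcal{S}_n}$ is the induced joint law of $(W,\mathcal{S}_n)$, $P_{WZ_i}$ the induced joint law of $(W,Z_i)$, and $P_W$ the induced marginal law of $W$. Under $P_W\otimes\mu$, $W\sim P_W$ and $Z\sim\mu$ are independent. $\mathbb{E}_{W\mathcal{S}_n}$ and $\mathbb{E}_W$ denote expectation under $P_{W\mathcal{S}_n}$ and $P_W$. Definitions. $w^*\in\arg\min_{w\in\mathcal{W}}\mathbb{E}_{Z\sim\mu}[\ell(w,Z)]$ is an optimal hypothesis; $r(w,z)=\ell(w,z)-\ell(w^*,z)$. Generalization error: $\mathcal{E}(w,\mathcal{S}_n)=\mathbb{E}_{Z\sim\mu}[\ell(w,Z)]-\frac1n\sum_{i=1}^n\ell(w,Z_i)$. Excess risk: $\mathcal{R}(w)=\mathbb{E}_{Z\sim\mu}[\ell(w,Z)]-\mathbb{E}_{Z\sim\mu}[\ell(w^*,Z)]$. Empirical excess risk: $\hat{\mathcal{R}}(w,\mathcal{S}_n)=\frac1n\sum_{i=1}^n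 r(w,Z_i)$. $I(W;Z_i)=D(P_{WZ_i}\,\|\,P_W\otimes\mu)$ is the mutual information (KL divergence, natural logarithm). A random variable $X$ is $\sigma$-sub-Gaussian ($\sigma>0$) if $\log\mathbb{E}[e^{\eta(X-\mathbb{E}[X])}]\le \sigma^2\eta^2/2$ for all $\eta\in\mathbb{R}$. *)

(* Defs.v *)
From HB Require Import structures.
From mathcomp Require Import all_boot all_order all_algebra.
From mathcomp Require Import all_classical all_reals all_analysis.

Set Implicit Arguments.
Unset Strict Implicit.
Unset Printing Implicit Defensive.

Import Order.TTheory GRing.Theory Num.Theory.

Local Open Scope classical_set_scope.
Local Open Scope charge_scope.
Local Open Scope ring_scope.
Local Open Scope ereal_scope.

Section pair_rv.
Context d d1 d2 (T : measurableType d) (T1 : measurableType d1)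
  (T2 : measurableType d2).

Definition pair_fun (X : T -> T1) (Y : T -> T2) : T -> T1 * T2 :=
  fun t => (X t, Y t).

Lemma measurable_pair_fun (X : {mfun T >-> T1}) (Y : {mfun T >-> T2}) :
  measurable_fun setT (pair_fun X Y).
Proof. exact: measurable_fun_pair. Qed.

HB.instance Definition _ (X : {mfun T >-> T1}) (Y : {mfun T >-> T2}) :=
  isMeasurableFun.Build _ _ T (T1 * T2)%type (pair_fun X Y)
    (measurable_pair_fun X Y).

Definition pair_rv (X : {mfun T >-> T1}) (Y : {mfun T >-> T2}) :
  {mfun T >-> (T1 * T2)%type} := pair_fun X Y.

End pair_rv.

Section coord_rv.
Context d d1 (T : measurableType d) (T1 : measurableType d1) (n : nat).

Definition coord_fun (S : T -> n.-tuple T1) (i : 'I_n) : T -> T1 :=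
  fun t => tnth (S t) i.

Lemma measurable_coord_fun (S : {mfun T >-> n.-tuple T1}) i :
  measurable_fun setT (coord_fun S i).
Proof. exact: (measurableT_comp (@measurable_tnth _ T1 n i)). Qed.

HB.instance Definition _ (S : {mfun T >-> n.-tuple T1}) i :=
  isMeasurableFun.Build _ _ T T1 (coord_fun S i) (measurable_coord_fun S i).

Definition coord_rv (S : {mfun T >-> n.-tuple T1}) (i : 'I_n) :
  {mfun T >-> T1} := coord_fun S i.

End coord_rv.

Section information.
Context d (T : measurableType d) (R : realType).

Definition kl_divergence (P Q : probability T R) : \bar R :=
  if pselect (P `<< Q) then
    \int[P]_x lne (('d (charge_of_finite_measure P) '/d Q) x)
  else +oo.

(* Integrability makes the mean of X, hence the centred variable, meaningful;
   lne +oo = +oo, so the bound forces the exponential moments to be finite. *)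
Definition sub_gaussian (P : probability T R) (sigma : R) (X : T -> R) : Prop :=
  [/\ (0 < sigma)%R,
      P.-integrable setT (EFin \o X) &
      forall eta : R,
        lne 'E_P[fun x => expR (eta * (X x - fine 'E_P[X]))]
          <= (sigma ^+ 2 * eta ^+ 2 / 2)%:E].

End information.

Section learning.
Context dZ dW (Z : measurableType dZ) (W : measurableType dW) (R : realType).
Variables (mu : probability Z R) (l : W -> Z -> R).

Definition risk (w : W) : \bar R := 'E_mu[l w].

Definition optimal_hypothesis (wstar : W) : Prop :=
  forall w, risk wstar <= risk w.

Definition relative_loss (wstar w : W) (z : Z) : R := (l w z - l wstar z)%R.

Definition generalization_error n (w : W) (s : n.-tuple Z) : \bar R :=
  risk w - (n%:R^-1 * \sum_(i < n) l w (tnth s i))%:E.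

Definition excess_risk (wstar w : W) : \bar R := risk w - risk wstar.

Definition empirical_excess_risk n (wstar w : W) (s : n.-tuple Z) : R :=
  (n%:R^-1 * \sum_(i < n) relative_loss wstar w (tnth s i))%R.

Context d (Omega : measurableType d) (P : probability Omega R).

(* Taking some of the B i to be setT yields the product rule for every
   subfamily, and all but one yields that each coordinate has law mu. *)
Definition iid_sample n (S : {RV P >-> n.-tuple Z}) : Prop :=
  forall B : 'I_n -> set Z, (forall i, measurable (B i)) ->
    P [set t | forall i, B i (tnth (S t) i)] = \prod_(i < n) mu (B i).

(* The kernel A is the conditional distribution of the output given S. *)
Definition algorithm_output n (A : R.-pker (n.-tuple Z) ~> W)
    (S : {RV P >-> n.-tuple Z}) (V : {RV P >-> W}) : Prop :=
  forall (B : set W) (C : set (n.-tuple Z)), measurable B -> measurable C ->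
    P (V @^-1` B `&` S @^-1` C) = \int[P]_(t in S @^-1` C) A (S t) B.

(* Under iid_sample, mu is the law of the i-th coordinate of S. *)
Definition mutual_information n (V : {RV P >-> W}) (S : {RV P >-> n.-tuple Z})
    (i : 'I_n) : \bar R :=
  kl_divergence (distribution P (pair_rv V (coord_rv S i)))
                (distribution P V \x mu).

End learning.

(* Main.v *)
(* Change of measure: if P has log-density L with respect to Q, then
   E_P[exp (g - L)] <= E_Q[exp g], and t <= exp t - 1 with t = g - L gives the
   Donsker-Varadhan bound E_P[g] <= KL(P || Q) as soon as E_Q[exp g] <= 1.  For
   P the law of (W, Z_i), Q = P_W x mu and g = eta (E_Q[r] - r) - eta^2
   sigma^2 / 2, this reads a_eta E_Q[r] <= E[r(W, Z_i)] + I(W; Z_i) / eta.  It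
   remains to average over i: E_Q[r] is the expected excess risk by Fubini, and
   the expected generalization error is E_Q[r] minus the expected empirical
   excess risk because each Z_i has law mu.  If some I(W; Z_i) is infinite the
   right-hand sides are +oo; otherwise Donsker-Varadhan applied to both signs
   of eta also yields the integrability of r(W, Z_i). *)
Require Import Defs.
From HB Require Import structures.
From mathcomp Require Import all_boot all_order all_algebra.
From mathcomp Require Import all_classical all_reals all_analysis.
From mathcomp Require Import measurable_realfun.
From mathcomp Require Import ring lra.

Set Implicit Arguments.
Unset Strict Implicit.
Unset Printing Implicit Defensive.

Import Order.TTheory GRing.Theory Num.Theory.

Local Open Scope classical_set_scope.
Local Open Scope ring_scope.
Local Open Scope ereal_scope.

(** * Constants and exponentials under the integral *)

Lemma integral_probability_cst d (T : measurableType d) (R : realType)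
    (P : probability T R) (c : R) : \int[P]_x c%:E = c%:E.
Proof.
by rewrite integral_cst//= -[RHS]mule1; congr *%E; exact: probability_setT.
Qed.

Lemma measurable_EFin_expR d (T : measurableType d) (R : realType)
    (h : T -> R) : measurable_fun setT h ->
  measurable_fun setT (fun x => (expR (h x))%:E).
Proof.
move=> mh; apply/measurable_EFinP.
exact: (measurableT_comp (@measurable_expR R)).
Qed.

(** * Change of measure and the Donsker-Varadhan bound *)

Section kl_divergence_variational.
Context d (T : measurableType d) (R : realType) (P Q : probability T R).
Hypothesis PQ : P `<< Q.

(** This version of the density dP/dQ is nonnegative and finite at every point, so [fine] loses
    nothing. *)
Let F : T -> \bar R := Radon_Nikodym_SigmaFinite.f P Q.

(* As ln 0 = 0, this vanishes where the density is zero, which is a P-null set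
   but may have positive Q-measure. *)
Definition log_likelihood_ratio (x : T) : R := ln (fine (F x)).

Local Notation L := log_likelihood_ratio.

Let mF : measurable_fun setT F.
Proof. exact: measurable_int (Radon_Nikodym_SigmaFinite.f_integrable PQ). Qed.

Let F_ge0 x : 0 <= F x. Proof. exact: Radon_Nikodym_SigmaFinite.f_ge0. Qed.

Let F_fin x : F x \is a fin_num.
Proof. exact: Radon_Nikodym_SigmaFinite.f_fin_num. Qed.

Lemma measurable_log_likelihood_ratio : measurable_fun setT L.
Proof.
apply: (measurableT_comp (@measurable_ln R)).
exact: (measurableT_comp (fine_measurable measurableT)).
Qed.

(** The two versions of the density agree Q-almost everywhere, hence P-almost everywhere by
    domination. The conventions [lne 0 = -oo] and [ln 0 = 0] differ only where [F] vanishes, a set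
    of P-measure equal to the Q-integral of [F] over it, that is 0. *)
Lemma kl_divergenceE : kl_divergence P Q = \int[P]_x (L x)%:E.
Proof.
rewrite /kl_divergence; case: pselect => // PQ'.
set D := Radon_Nikodym _ _.
have mD : measurable_fun setT D.
  by apply: measurable_int; exact: Radon_Nikodym_integrable.
have D_fin x : D x \is a fin_num by exact: Radon_Nikodym_fin_num.
apply: ae_eq_integral => //.
- rewrite (_ : (fun x => _) =
      fun x => if (fine (D x) <= 0)%R then -oo else (ln (fine (D x)))%:E).
    have mfD : measurable_fun setT (fine \o D).
      exact: (measurableT_comp (fine_measurable measurableT)).
    apply: measurable_fun_ifT => //.
      exact: measurable_fun_ler.
    by apply/measurable_EFinP; exact: (measurableT_comp (@measurable_ln R)).
  by apply/funext => x; rewrite -[in LHS](fineK (D_fin x)).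
- by apply/measurable_EFinP; exact: measurable_log_likelihood_ratio.
have FD : ae_eq P setT F D.
  apply: (null_dominates_ae_eq _ PQ) => //.
  exact: ae_eq_Radon_Nikodym_SigmaFinite.
have F_gt0 : {ae P, forall x, 0 < F x}.
  have mN : measurable (F @^-1` [set 0]).
    by rewrite -[X in measurable X]setTI; exact: mF.
  exists (F @^-1` [set 0]); split => //.
    rewrite (Radon_Nikodym_SigmaFinite.f_integral PQ)//.
    by apply: integral0_eq.
  move=> x /=/negP; rewrite -leNgt => Fx.
  by apply/eqP; rewrite eq_le Fx F_ge0.
apply: filterS2 FD F_gt0 => x /= + + _ => /(_ I) <- Fx.
by rewrite /L -[in LHS](fineK (F_fin x)) lne_EFin// fine_gt0// Fx ltey_eq F_fin.
Qed.

(** The left side is the Q-integral of exp(g - L) F. Where F > 0 this integrand equals exp g; where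
    F = 0 it is 0, which is why only an inequality holds. *)
Lemma integral_expR_tilt (g : T -> R) : measurable_fun setT g ->
  \int[P]_x (expR (g x - L x))%:E <= \int[Q]_x (expR (g x))%:E.
Proof.
move=> mg.
have mgL : measurable_fun setT (fun x => g x - L x)%R.
  by apply: measurable_funB => //; exact: measurable_log_likelihood_ratio.
rewrite -(Radon_Nikodym_SigmaFinite.change_of_variables PQ)//; last first.
  exact: measurable_EFin_expR.
apply: ge0_le_integral => //.
- by move=> x _; rewrite mule_ge0// lee_fin expR_ge0.
- by apply: emeasurable_funM => //; exact: measurable_EFin_expR.
- exact: measurable_EFin_expR.
move=> x _; rewrite -/F -(fineK (F_fin x)) -EFinM lee_fin /L expRB.
have : (0 <= fine (F x))%R by exact: fine_ge0.
rewrite le_eqVlt => /predU1P[<-|Fx]; first by rewrite mulr0 expR_ge0.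
by rewrite lnK ?posrE// divfK ?gt_eqF.
Qed.

Lemma integrable_expR_tilt (g : T -> R) : measurable_fun setT g ->
  \int[Q]_x (expR (g x))%:E < +oo ->
  P.-integrable setT (fun x => (expR (g x - L x))%:E).
Proof.
move=> mg goo; apply/integrableP; split.
  apply: measurable_EFin_expR.
  by apply: measurable_funB => //; exact: measurable_log_likelihood_ratio.
under eq_integral do rewrite gee0_abs ?lee_fin ?expR_ge0//.
exact: le_lt_trans (integral_expR_tilt mg) goo.
Qed.

Let integrable_expR_neg : P.-integrable setT (fun x => (expR (- L x))%:E).
Proof.
under eq_fun do rewrite -[(- L _)%R]sub0r.
apply: (@integrable_expR_tilt (cst 0%R)) => //.
rewrite /cst expR0 integral_probability_cst; exact: ltry.
Qed.

(** The negative part of [L] is at most exp(-L), whose P-integral is at most 1 by tilting g = 0. A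
    divergence below +oo then forces the positive part to be integrable too. *)
Lemma integrable_log_likelihood_ratio :
  kl_divergence P Q < +oo -> P.-integrable setT (EFin \o L).
Proof.
rewrite kl_divergenceE => Loo.
have {}Loo : \int[P]_x (EFin \o L) x < +oo by [].
have mL : measurable_fun setT (EFin \o L).
  by apply/measurable_EFinP; exact: measurable_log_likelihood_ratio.
have Ln : \int[P]_x (EFin \o L)^\- x < +oo.
  apply: le_lt_trans _ (integrable_lty _ integrable_expR_neg) => //.
  apply: ge0_le_integral => //.
  - exact: measurable_funeneg.
  - exact: measurable_int integrable_expR_neg.
  move=> x _; rewrite funenegE /= -EFin_max lee_fin ge_max expR_ge0 andbT.
  by have := expR_ge1Dx (- L x); lra.
have Lp : \int[P]_x (EFin \o L)^\+ x < +oo.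
  have : 0 <= \int[P]_x (EFin \o L)^\- x by exact: integral_ge0.
  move: Loo Ln; rewrite integralE.
  case: (\int[P]_x (EFin \o L)^\- x) => [m| |] //.
  by case: (\int[P]_x (EFin \o L)^\+ x) => [p _ _ _| |]; rewrite ?ltry ?addye //=.
apply/integrableP; split => //.
under eq_integral do rewrite -/((abse \o (EFin \o L)) _) fune_abse.
rewrite ge0_integralD//; first exact: lte_add_pinfty.
- exact: measurable_funepos.
- exact: measurable_funeneg.
Qed.

(** Integrating -L <= exp(-L) - 1 under P gives -KL <= 1 - 1. *)
Lemma dominated_kl_divergence_ge0 : 0 <= kl_divergence P Q.
Proof.
have [Poo|] := ltP (kl_divergence P Q) +oo; last first.
  by rewrite leye_eq => /eqP ->.
have iL := integrable_log_likelihood_ratio Poo.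
rewrite kl_divergenceE.
have : \int[P]_x (- (EFin \o L) x) <= \int[P]_x ((expR (- L x))%:E - 1).
  apply: le_integral => //.
  - exact: integrableN.
  - by apply: integrableB => //; exact: finite_measure_integrable_cst.
  move=> x _; rewrite /= lee_fin.
  by have := expR_ge1Dx (- L x); lra.
rewrite integralN; last exact: integrable_add_def.
rewrite integralB//; last exact: finite_measure_integrable_cst.
rewrite integral_probability_cst.
have h1 : \int[P]_x (expR (- L x))%:E <= 1.
  under eq_integral do rewrite -[(- L _)%R]sub0r.
  rewrite (le_trans (@integral_expR_tilt (cst 0%R) _))//.
  by rewrite /cst expR0 integral_probability_cst.
move=> h2; rewrite -oppe_le0; apply: le_trans h2 _.
by rewrite sube_le0.
Qed.

(** Shifting by [c] normalises the exponential moments to at most 1. The bound on [X] yields the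
    inequality; the bound on [- X] is there to control the negative part of [X] under P, hence its
    integrability. *)
Lemma donsker_varadhan (X : T -> R) (c : R) :
    measurable_fun setT X -> kl_divergence P Q < +oo ->
    \int[Q]_x (expR (X x))%:E <= (expR c)%:E ->
    \int[Q]_x (expR (- X x))%:E <= (expR c)%:E ->
  P.-integrable setT (EFin \o X) /\
  \int[P]_x (X x)%:E <= kl_divergence P Q + c%:E.
Proof.
move=> mX Poo Xc XNc.
have iL := integrable_log_likelihood_ratio Poo.
have shift (Y : T -> R) : measurable_fun setT Y ->
    \int[Q]_x (expR (Y x))%:E <= (expR c)%:E ->
    \int[Q]_x (expR (Y x - c))%:E <= 1.
  move=> mY Yc; under eq_integral do rewrite expRB EFinM.
  rewrite ge0_integralZr ?lee_fin ?invr_ge0 ?expR_ge0//; last first.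
    exact: measurable_EFin_expR.
  apply: (@le_trans _ _ ((expR c)%:E * (expR c)^-1%:E)).
    by rewrite lee_wpmul2r// lee_fin invr_ge0 expR_ge0.
  by rewrite -EFinM divff// gt_eqF// expR_gt0.
have mB (Y : T -> R) : measurable_fun setT Y ->
  measurable_fun setT (fun x => Y x - c)%R by move=> ?; exact: measurable_funB.
have mXN : measurable_fun setT (fun x => - X x)%R by exact: measurableT_comp.
have iv (Y : T -> R) (mY : measurable_fun setT Y)
    (Yc : \int[Q]_x (expR (Y x))%:E <= (expR c)%:E) :=
  integrable_expR_tilt (mB _ mY) (le_lt_trans (shift _ mY Yc) (ltry 1)).
have iX : P.-integrable setT (EFin \o X).
  (* The dominating function comes from 1 + t <= exp t at t = X - c - L and at t = -X - c - L. *)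
  apply: (@le_integrable _ _ _ _ _ measurableT _
      (fun x => `|(EFin \o L) x| + (expR (X x - c - L x))%:E
                + (expR (- X x - c - L x))%:E + (`|c|)%:E)) => //.
  - exact/measurable_EFinP.
  - move=> x _ /=; rewrite lee_fin.
    rewrite [leRHS]ger0_norm; last by rewrite !addr_ge0// expR_ge0.
    have := expR_ge1Dx (X x - c - L x); have := expR_ge1Dx (- X x - c - L x).
    have := expR_ge0 (X x - c - L x); have := expR_ge0 (- X x - c - L x).
    have := ler_norm (L x); have := ler_norm c.
    by rewrite ler_norml => *; apply/andP; split; lra.
  - apply: integrableD => //; last exact: finite_measure_integrable_cst.
    by do 2 (apply: integrableD => //; last exact: iv); exact: integrable_abse.
split => //.
have : \int[P]_x ((EFin \o X) x - (EFin \o L) x)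
       <= \int[P]_x ((expR (X x - c - L x))%:E + (c - 1)%:E).
  apply: le_integral => //.
  - exact: integrableB.
  - by apply: integrableD => //; [exact: iv|exact: finite_measure_integrable_cst].
  move=> x _; rewrite /= lee_fin.
  by have := expR_ge1Dx (X x - c - L x); lra.
rewrite integralB// integralD//; last 2 first.
- exact: iv.
- exact: finite_measure_integrable_cst.
rewrite integral_probability_cst kl_divergenceE => XL.
have v1 := le_trans (integral_expR_tilt (mB _ mX)) (shift _ mX Xc).
have {v1} := le_trans XL (leeD2r (c - 1)%:E v1).
rewrite -EFinD [(1 + _)%R]addrC subrK => {}XL.
rewrite addeC -leeBlDr//.
exact: integrable_fin_num.
Qed.

End kl_divergence_variational.

(** * Nonnegativity of the divergence and sub-Gaussian decoupling *)

Lemma kl_divergence_lty_dominated d (T : measurableType d) (R : realType)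
    (P Q : probability T R) : kl_divergence P Q < +oo -> P `<< Q.
Proof. by rewrite /kl_divergence; case: (pselect (P `<< Q)). Qed.

Lemma kl_divergence_ge0 d (T : measurableType d) (R : realType)
    (P Q : probability T R) : 0 <= kl_divergence P Q.
Proof.
have [PQ|nPQ] := pselect (P `<< Q); first exact: dominated_kl_divergence_ge0.
by rewrite /kl_divergence; case: (pselect (P `<< Q)).
Qed.

Lemma lne_le_expR (R : realType) (x : \bar R) (c : R) :
  lne x <= c%:E -> x <= (expR c)%:E.
Proof.
case: x => [r| |]; [|by rewrite /= leye_eq|by move=> _; rewrite leNye].
have [r0 _|r0] := leP r 0%R.
  by rewrite lee_fin (le_trans r0)// expR_ge0.
by rewrite lne_EFin// !lee_fin => rc; rewrite -[leLHS]lnK ?posrE// ler_expR.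
Qed.

(** Donsker-Varadhan for -eta (X - m), with m the Q-mean and c = sigma^2 eta^2 / 2, divided by eta.
    The sub-Gaussian bound is even in its parameter, so the same [c] serves both signs. *)
Lemma sub_gaussian_decoupling d (T : measurableType d) (R : realType)
    (P Q : probability T R) (sigma eta : R) (X : T -> R) :
  (0 < eta)%R -> sub_gaussian Q sigma X -> kl_divergence P Q < +oo ->
  P.-integrable setT (EFin \o X) /\
  (fine 'E_Q[X] - eta * sigma ^+ 2 / 2
    <= fine (\int[P]_x (X x)%:E) + eta^-1 * fine (kl_divergence P Q))%R.
Proof.
move=> eta0 [sigma0 iX sgX] Poo; set m := fine _.
have mX : measurable_fun setT X.
  by apply/measurable_EFinP; exact: measurable_int iX.
have mgf t : \int[Q]_x (expR (t * (X x - m)))%:E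
    <= (expR (sigma ^+ 2 * t ^+ 2 / 2))%:E.
  by apply: lne_le_expR; have := sgX t; rewrite -/m unlock.
have mY : measurable_fun setT (fun x => - eta * (X x - m))%R.
  by apply: measurable_funM => //; exact: measurable_funB.
have [||iY Ym] := donsker_varadhan
  (kl_divergence_lty_dominated Poo) mY Poo (c := sigma ^+ 2 * eta ^+ 2 / 2).
- by have := mgf (- eta)%R; rewrite sqrrN.
- under eq_integral do rewrite mulNr opprK; exact: mgf.
(* [X] is an affine function of the centred variable and so inherits its integrability under P. *)
have XE x : X x = (m - eta^-1 * (- eta * (X x - m)))%R.
  by rewrite mulNr mulrN opprK mulrA mulVf ?gt_eqF// mul1r addrC subrK.
have iPX : P.-integrable setT (EFin \o X).
  apply: (@eq_integrable _ _ _ P _ measurableT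
      (fun x => m%:E - eta^-1%:E * (EFin \o (fun x => - eta * (X x - m))%R) x)).
    by move=> x _; rewrite /= [in RHS]XE.
  apply: integrableB => //; first exact: finite_measure_integrable_cst.
  exact: integrableZl.
split => //; move: Ym.
have -> : \int[P]_x (- eta * (X x - m))%:E
    = (- eta * (fine (\int[P]_x (X x)%:E) - m))%:E.
  under eq_integral do rewrite EFinM EFinB.
  rewrite integralZl//; last first.
    by apply: integrableB => //; exact: finite_measure_integrable_cst.
  rewrite integralB//; last exact: finite_measure_integrable_cst.
  have iX_fin : \int[P]_x (X x)%:E \is a fin_num.
    exact: (integrable_fin_num measurableT iPX).
  by rewrite integral_probability_cst EFinM EFinB (fineK iX_fin).
have /fineK <- : kl_divergence P Q \is a fin_num.
  by rewrite ge0_fin_numE// kl_divergence_ge0.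
rewrite -EFinD lee_fin /=; set p := fine (integral _ _ _); set k := fine _ => h.
have {}h : (eta * (m - p) <= k + sigma ^+ 2 * eta ^+ 2 / 2)%R by lra.
have : (m - p <= eta^-1 * (k + sigma ^+ 2 * eta ^+ 2 / 2))%R.
  by rewrite ler_pdivlMl.
rewrite mulrDr [X in (_ <= _ + X -> _)%R](_ : _ = eta * sigma ^+ 2 / 2)%R.
  by lra.
by field; rewrite gt_eqF.
Qed.

(** * Transfer of integrability and averages of integrals *)

Lemma ae_eq_integrable d (T : measurableType d) (R : realType)
    (mu : {measure set T -> \bar R}) (f g : T -> \bar R) :
  measurable_fun setT g -> ae_eq mu setT f g ->
  mu.-integrable setT f -> mu.-integrable setT g.
Proof.
move=> mg fg /integrableP[mf foo]; apply/integrableP; split => //.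
rewrite (ae_eq_integral (abse \o f)) => //.
- exact: measurableT_comp.
- exact: measurableT_comp.
- by apply: filterS fg => x /= /[apply] <-.
Qed.

Lemma integrable_distribution d d' (T : measurableType d)
    (U : measurableType d') (R : realType) (P : probability T R)
    (X : {RV P >-> U}) (f : U -> \bar R) :
  (distribution P X).-integrable setT f -> P.-integrable setT (f \o X).
Proof.
move=> /integrableP[mf foo]; apply/integrableP; split.
  exact: measurableT_comp.
rewrite -(ge0_integral_distribution X (f := abse \o f))//=.
exact: measurableT_comp.
Qed.

Lemma integral_average d (T : measurableType d) (R : realType)
    (P : {measure set T -> \bar R}) n (Y : 'I_n -> T -> R) :
  (forall i, P.-integrable setT (EFin \o Y i)) ->
  P.-integrable setT (fun t => (n%:R^-1 * \sum_(i < n) Y i t)%:E) /\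
  \int[P]_t (n%:R^-1 * \sum_(i < n) Y i t)%:E
    = n%:R^-1%:E * \sum_(i < n) \int[P]_t (Y i t)%:E.
Proof.
move=> iY.
have E t : (n%:R^-1 * \sum_(i < n) Y i t)%:E
    = n%:R^-1%:E * \sum_(i < n) (Y i t)%:E.
  by rewrite EFinM -sumEFin.
have iS : P.-integrable setT (fun t => \sum_(i < n) (Y i t)%:E).
  by apply: integrable_sum => // i _; exact: iY.
split; first by under eq_fun do rewrite E; exact: integrableZl.
under eq_integral do rewrite E.
by rewrite integralZl// integral_sum// => i; exact: iY.
Qed.

(** * Measurability and mean of the excess risk; marginals of the sample *)

Section excess_risk.
Context dZ dW (Z : measurableType dZ) (W : measurableType dW) (R : realType).
Variables (mu : probability Z R) (l : W -> Z -> R).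
Hypothesis ml : measurable_fun setT (fun x : W * Z => l x.1 x.2).

(** No integrability of [l w] is available for general [w], so Tonelli is applied to the positive
    and negative parts separately. *)
Lemma measurable_risk : measurable_fun setT (risk mu l).
Proof.
pose f : W * Z -> \bar R := EFin \o (fun x => l x.1 x.2).
have mf : measurable_fun setT f by exact/measurable_EFinP.
rewrite (_ : risk mu l = fun w =>
    \int[mu]_z f^\+ (w, z) - \int[mu]_z f^\- (w, z)); last first.
  apply/funext => w; rewrite /risk unlock integralE.
  by congr (_ - _); apply: eq_integral => z _; rewrite ?funeposE ?funenegE.
apply: emeasurable_funB.
- by apply: (measurable_fun_fubini_tonelli_F f^\+) => //; exact: measurable_funepos.
- by apply: (measurable_fun_fubini_tonelli_F f^\-) => //; exact: measurable_funeneg.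
Qed.

Lemma measurable_excess_risk wstar :
  measurable_fun setT (excess_risk mu l wstar).
Proof. by apply: emeasurable_funB => //; exact: measurable_risk. Qed.

(** Fubini makes r(w, .) integrable for almost every [w] only. For such [w], adding back [l wstar]
    shows that [l w] is integrable, so the difference of risks is the integral of r(w, .). *)
Lemma integral_excess_risk (PW : probability W R) wstar :
  mu.-integrable setT (EFin \o l wstar) ->
  (PW \x mu).-integrable setT
    (EFin \o (fun x => relative_loss l wstar x.1 x.2)) ->
  PW.-integrable setT (excess_risk mu l wstar) /\
  \int[PW]_w excess_risk mu l wstar w
    = \int[PW \x mu]_x (relative_loss l wstar x.1 x.2)%:E.
Proof.
move=> ilstar ir.
set f := EFin \o _ in ir.
have fE : ae_eq PW setT (fubini_F mu f) (excess_risk mu l wstar).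
  apply: filterS (ae_integrable1 ir) => w irw _.
  rewrite /excess_risk /risk unlock /fubini_F.
  have ilw : mu.-integrable setT (EFin \o l w).
    apply: (@eq_integrable _ _ _ mu _ measurableT
        (fun z => f (w, z) + (EFin \o l wstar) z)); last exact: integrableD.
    by move=> z _; rewrite /f /= /relative_loss -EFinD subrK.
  by rewrite -integralB.
have iF := integrable_fubini_F ir.
have iE := ae_eq_integrable (measurable_excess_risk wstar) fE iF.
split => //; rewrite -(integral12_prod_meas1 ir).
apply: ae_eq_integral => //.
- exact: measurable_int iE.
- exact: measurable_int iF.
- exact: ae_eq_sym.
Qed.

Lemma distribution_coord_rv d (Omega : measurableType d)
    (P : probability Omega R) n (S : {RV P >-> n.-tuple Z}) (i : 'I_n) B :
  iid_sample mu S -> measurable B -> distribution P (coord_rv S i) B = mu B.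
Proof.
move=> iidS mB; pose C j := if j == i then B else setT.
have mC j : measurable (C j) by rewrite /C; case: ifP.
have := iidS C mC; rewrite (bigD1 i)//= big1 => [|j /negbTE ji]; last first.
  by rewrite /C ji; exact: probability_setT.
rewrite mule1 {2}/C eqxx => <-; congr (P _); apply/seteqP; split => t /=.
  by move=> St j; rewrite /C; case: eqP => // ->.
by move=> /(_ i); rewrite /C eqxx.
Qed.

End excess_risk.

(* MathComp-Analysis world.
   In both bounds the sum on the right is the dual addition of \bar R, so that
   the right-hand side is +oo as soon as some I(W;Z_i) is +oo. *)
Theorem theorem3 (R : realType) (dZ dW dO : measure_display)
    (Z : measurableType dZ) (W : measurableType dW)
    (Omega : measurableType dO)
    (mu : probability Z R) (l : W -> Z -> R) (n : nat)
    (A : R.-pker (n.-tuple Z) ~> W)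
    (P : probability Omega R)
    (S : {RV P >-> n.-tuple Z}) (V : {RV P >-> W})
    (wstar : W) (sigma eta : R) :
  (1 <= n)%N ->
  measurable_fun setT (fun x : W * Z => l x.1 x.2) ->
  iid_sample mu S ->
  algorithm_output A S V ->
  mu.-integrable setT (EFin \o l wstar) ->
  optimal_hypothesis mu l wstar ->
  let P_WS := distribution P (pair_rv V S) in
  let P_W := distribution P V in
  let r := fun x : W * Z => relative_loss l wstar x.1 x.2 in
  sub_gaussian (P_W \x mu) sigma r ->
  let Er := fine 'E_(P_W \x mu)[r] in
  (0 < eta < 2 * Er / sigma ^+ 2)%R ->
  let a := (1 - eta * sigma ^+ 2 / (2 * Er))%R in
  let empirical := 'E_P_WS[fun x => empirical_excess_risk l wstar x.1 x.2] in
  let information := \sum_(i < n) mutual_information mu V S i in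
  let bound := fun c : R =>
    (c%:E * empirical + (n%:R * eta * a)^-1%:E * information)%dE in
  \int[P_WS]_x generalization_error mu l x.1 x.2 <= bound ((1 - a) / a)%R
  /\
  \int[P_W]_w excess_risk mu l wstar w <= bound a^-1%R.
Proof.
move=> n_gt0 ml iidS _ ilstar _ P_WS P_W r sgr Er /andP[eta_gt0 eta_lt] a
  empirical information bound.
have [sigma_gt0 ir _] := sgr.
have sigma2_gt0 : (0 < sigma ^+ 2)%R by rewrite exprn_gt0.
have etaEr : (eta * sigma ^+ 2 < 2 * Er)%R by rewrite -ltr_pdivlMr.
(* The admissible interval for [eta] is nonempty, which forces a positive mean. *)
have Er_gt0 : (0 < Er)%R.
  have := mulr_gt0 eta_gt0 sigma2_gt0; lra.
have a_gt0 : (0 < a)%R by rewrite /a subr_gt0 ltr_pdivrMr ?mul1r// mulr_gt0.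
have n_gt0' : (0 < n%:R :> R)%R by rewrite ltr0n.
have [ie iE] := integral_excess_risk ml ilstar ir.
have {}iE : \int[P_W]_w excess_risk mu l wstar w = Er%:E.
  by rewrite iE /Er unlock fineK//; exact: (integrable_fin_num measurableT ir).
have I_ge0 i : 0 <= mutual_information mu V S i by exact: kl_divergence_ge0.
have infoE (c : R) : information = +oo -> bound c = +oo.
  rewrite /bound => ->; rewrite gt0_muley ?lte_fin ?invr_gt0 ?mulr_gt0//.
  by case: (c%:E * empirical).
have [Ioo|Ifin] := eqVneq information +oo.
  by rewrite !infoE// !leey.
(* Nonnegative terms exclude -oo, so a single infinite term would make the whole sum +oo. *)
have {infoE} I_lty i : mutual_information mu V S i < +oo.
  rewrite ltey; apply: contra Ifin => Ii; rewrite /information esum_eqy.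
    by apply/existsP; exists i.
  by move=> j _; rewrite gt_eqF// (lt_le_trans _ (I_ge0 j)).
pose Q i := distribution P (pair_rv V (coord_rv S i)).
have decouple i := sub_gaussian_decoupling eta_gt0 sgr (I_lty i).
have irS i : P.-integrable setT (fun t => (r (V t, tnth (S t) i))%:E).
  exact: (integrable_distribution (decouple i).1).
have mr : measurable_fun setT (EFin \o r) by exact: measurable_int ir.
have irSE i : \int[P]_t (r (V t, tnth (S t) i))%:E = \int[Q i]_x (r x)%:E.
  by rewrite (integral_distribution (X := pair_rv V (coord_rv S i)) mr (irS i)).
(* [e] is the real value of the expected empirical excess risk, computed from the laws of the pairs
   (W, Z_i). *)
pose e := (n%:R^-1 * \sum_(i < n) fine (\int[Q i]_x (r x)%:E))%R.
have [iemp empE] := integral_average irS.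
have {}empE : \int[P]_t (n%:R^-1 * \sum_(i < n) r (V t, tnth (S t) i))%:E = e%:E.
  rewrite empE /e EFinM -sumEFin; congr (_ * _); apply: eq_bigr => i _.
  rewrite irSE fineK//.
  exact: (integrable_fin_num measurableT (decouple i).1).
have mtnth (f : W * Z -> R) (i : 'I_n) : measurable_fun setT f ->
    measurable_fun setT (fun x : W * n.-tuple Z => f (x.1, tnth x.2 i)).
  move=> mf; apply: (measurableT_comp mf); apply: measurable_fun_pair => //.
  exact: (measurableT_comp (measurable_tnth i)).
have maverage (f : W * Z -> R) : measurable_fun setT f ->
    measurable_fun setT (fun x : W * n.-tuple Z =>
      (n%:R^-1 * \sum_(i < n) f (x.1, tnth x.2 i))%:E).
  move=> mf; apply/measurable_EFinP; apply: measurable_funM => //.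
  by apply: measurable_sum => i; exact: mtnth.
have empiricalE : empirical = e%:E.
  rewrite /empirical unlock -empE.
  by rewrite (integral_distribution (maverage r _))//; exact/measurable_EFinP.
have ilS i : P.-integrable setT (EFin \o (fun t => l wstar (tnth (S t) i))).
  have : (distribution P (coord_rv S i)).-integrable setT (EFin \o l wstar).
    have [mlstar looe] := integrableP _ _ _ ilstar.
    apply/integrableP; split => //.
    rewrite (eq_measure_integral mu)// => B mB _.
    exact: distribution_coord_rv.
  exact: integrable_distribution.
have ilSE i : \int[P]_t (l wstar (tnth (S t) i))%:E = risk mu l wstar.
  rewrite -(integral_distribution (X := coord_rv S i) (measurable_int _ ilstar) (ilS i)).
  rewrite /risk unlock; apply: eq_measure_integral => B mB _.
  exact: distribution_coord_rv.
have risk_fin : risk mu l wstar \is a fin_num.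
  by rewrite /risk unlock; exact: (integrable_fin_num measurableT ilstar).
have [iavg avgE] := integral_average ilS.
have {}avgE : \int[P]_t (n%:R^-1 * \sum_(i < n) l wstar (tnth (S t) i))%:E
    = risk mu l wstar.
  rewrite avgE -(fineK risk_fin); under eq_bigr do rewrite ilSE -(fineK risk_fin).
  rewrite sumEFin sumr_const card_ord -EFinM; congr EFin.
  by rewrite -[(fine _ *+ n)%R]mulr_natl mulKf// gt_eqF.
have ieV : P.-integrable setT (excess_risk mu l wstar \o V).
  exact: integrable_distribution.
have genE : \int[P_WS]_x generalization_error mu l x.1 x.2 = (Er - e)%:E.
  have mgen : measurable_fun setT
      (fun x : W * n.-tuple Z => generalization_error mu l x.1 x.2).
    apply: emeasurable_funB; last exact: (maverage _ ml).
    exact: (measurableT_comp (measurable_risk mu ml) measurable_fst).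
  pose emp t := (n%:R^-1 * \sum_(i < n) r (V t, tnth (S t) i))%R.
  pose avg t := (n%:R^-1 * \sum_(i < n) l wstar (tnth (S t) i))%R.
  (* Adding and subtracting the risk and the empirical risk of [wstar] leaves two integrable
     brackets, the second of mean zero. The identity also holds where the risk of the output is
     infinite. *)
  have genD t : generalization_error mu l (V t) (S t)
      = (excess_risk mu l wstar (V t) - (emp t)%:E)
        + (risk mu l wstar - (avg t)%:E).
    rewrite /generalization_error /excess_risk -(fineK risk_fin).
    have -> : (n%:R^-1 * \sum_(i < n) l (V t) (tnth (S t) i) = emp t + avg t)%R.
      rewrite -mulrDr -big_split/=; congr (_ * _)%R; apply: eq_bigr => i _.
      by rewrite subrK.
    case: (risk mu l (V t)) => [x| |] //=.
    by rewrite -!EFinB -EFinD; congr EFin; lra.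
  have igen1 : P.-integrable setT
      (fun t => excess_risk mu l wstar (V t) - (emp t)%:E).
    exact: integrableB.
  have irisk : P.-integrable setT (fun=> risk mu l wstar).
    by rewrite -(fineK risk_fin); exact: finite_measure_integrable_cst.
  have igen2 : P.-integrable setT (fun t => risk mu l wstar - (avg t)%:E).
    exact: integrableB.
  rewrite (integral_distribution (X := pair_rv V S) mgen)/=; last first.
    apply: (eq_integrable measurableT); last first.
      exact: (integrableD measurableT igen1 igen2).
    by move=> t _; rewrite /= genD.
  under eq_integral do rewrite genD.
  rewrite integralD// (integralB measurableT ieV iemp).
  rewrite (integralB measurableT irisk iavg).
  rewrite /emp /avg empE avgE.
  rewrite -(integral_distribution (X := V) (measurable_int _ ie) ieV) iE.
  by rewrite -(fineK risk_fin) integral_probability_cst subee// adde0.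
pose I := (\sum_(i < n) fine (mutual_information mu V S i))%R.
have informationE : information = I%:E.
  rewrite /I -sumEFin; apply: eq_bigr => i _; rewrite fineK//.
  by rewrite ge0_fin_numE.
(* This is the average over i of the decoupling inequalities. *)
have key : (Er - eta * sigma ^+ 2 / 2 <= e + n%:R^-1 * (eta^-1 * I))%R.
  have -> : (e + n%:R^-1 * (eta^-1 * I) = n%:R^-1 * \sum_(i < n)
      (fine (\int[Q i]_x (r x)%:E) + eta^-1 * fine (mutual_information mu V S i)))%R.
    by rewrite big_split/= mulrDr -mulr_sumr.
  rewrite ler_pdivlMl//.
  apply: (@le_trans _ _ (\sum_(i < n) (Er - eta * sigma ^+ 2 / 2))%R).
    by rewrite sumr_const card_ord mulr_natl.
  by apply: ler_sum => i _; exact: (decouple i).2.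
rewrite genE iE /bound empiricalE informationE !lee_fin /=.
(* The left side of [key] equals a Er; division by a > 0 gives the excess risk bound. *)
have keyE : (Er <= a^-1 * e + (n%:R * eta * a)^-1 * I)%R.
  have -> : (a^-1 * e + (n%:R * eta * a)^-1 * I = (e + n%:R^-1 * (eta^-1 * I)) / a)%R.
    by field; rewrite !gt_eqF.
  rewrite ler_pdivlMr//; apply: le_trans key.
  by rewrite le_eqVlt /a; apply/orP; left; apply/eqP; field; rewrite gt_eqF.
split => //.
(* Since (1 - a) / a = 1/a - 1, subtracting [e] from both sides of [keyE] gives the generalization
   bound. *)
have -> : ((1 - a) / a * e = a^-1 * e - e)%R by field; rewrite gt_eqF.
by lra.
Qed.
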